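(* Let $m$ be a positive integer, let $B$ be a Ferrers board, let $N=|B|$, and write $B=(b_0,\dots,b_N)$ by padding with columns of height $0$ on the left. Let $n(\omega_m(B))=(n_0,n_1,\dots)$. The number of Ferrers boards in the $m$-weight file equivalence class of $B$ is $$ \prod_{i\ge 1} \binom{n_i+n_{i-1}+\dots+n_{i-m}-1}{n_i}, $$ where $n_j=0$ for $j<0$.
   Context: Ferrers boards are written $(b_0,b_1,\dots,b_n)$ with $b_0=0\le b_1\le\dots\le b_n$ integers, the board being the set of the $b_j$ lowest cells of column $j$ in the quadrant grid (boards are sets of cells; left zero columns do not change the board); $|B|$ is the number of cells. $\omega_m(B)=(-b_0,m-b_1,2m-b_2,\dots,nm-b_n)$. For a vector $\nu$ of nonnegative integers, $n(\nu)=(n_0,n_1,\dots)$ where $n_i$ is the number of entries equal to $i$. A file placement on $B$ is a set of cells (rooks) no two in the same column; with $y_i$ rooks in row $i$, $\mathrm{wt}_m F=\prod_i 1\downarrow_{y_i,m}$, where $x\downarrow_{y,m}=x(x-m)\cdots(x-(y-1)m)$, $x\downarrow_{0,m}=1$; $f_{k,m}(B)=\sum_F\mathrm{wt}_m F$ over file placements with $k$ rooks. $B,B'$ are $m$-weight file equivalent if $f_{k,m}(B)=f_{k,m}(B')$ for all $k$. *)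

(* Defs.v *)
From HB Require Import structures.
From mathcomp Require Import all_boot all_order all_algebra.
Set Implicit Arguments.
Unset Strict Implicit.
Unset Printing Implicit Defensive.
Import GRing.Theory.

(* Column heights from left to right.  Left zero columns do not change a board,
   so a board is represented by its positive heights only; two boards are then
   the same exactly when they are equal in this type. *)
Record ferrers : Type := Ferrers {
  heights :> seq nat;
  _ : sorted leq heights && all (leq 1) heights }.

HB.instance Definition _ := [isSub for heights].
HB.instance Definition _ := [Equality of ferrers by <:].

(* A finite rectangle of the quadrant containing the board; a cell (j, i) lies
   in column j and row i, both counted from 0. *)
Definition cell (B : ferrers) : finType :=
  ('I_(size B) * 'I_(\max_(b <- B) b))%type.

Definition cells (B : ferrers) : {set cell B} :=
  [set c : cell B | c.2 < nth 0 B c.1].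

Definition file_placement (B : ferrers) (F : {set cell B}) : bool :=
  (F \subset cells B) &&
  [forall c in F, forall d in F, (c.1 == d.1) ==> (c == d)].

Definition falling (x : int) (y m : nat) : int :=
  (\prod_(s < y) (x - (s * m)%:Z))%R.

Definition wt (m : nat) (B : ferrers) (F : {set cell B}) : int :=
  (\prod_(i < \max_(b <- B) b) falling 1 #|[set c in F | c.2 == i]| m)%R.

Definition file_number (k m : nat) (B : ferrers) : int :=
  (\sum_(F : {set cell B} | file_placement F && (#|F| == k)) wt m F)%R.

Definition weight_file_equiv (m : nat) (B B' : ferrers) : Prop :=
  forall k : nat, file_number k m B = file_number k m B'.

(* (b_0, ..., b_n), meaningful when size B <= n.+1 *)
Definition padded (n : nat) (B : ferrers) : seq nat :=
  nseq (n.+1 - size B) 0 ++ B.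

Definition omega (m : nat) (b : seq nat) : seq int :=
  mkseq (fun j => (j * m)%:Z - (nth 0 b j)%:Z)%R (size b).

Definition occurrences (v : seq int) (i : nat) : nat := count_mem (Posz i) v.

(* binom(n_i + n_(i-1) + ... + n_(i-m) - 1, n_i), the terms of negative index
   being omitted.  Truncated subtraction matters only when the sum is 0; then
   n_i = 0 and the value is 1, as for the integer binomial binom(-1, 0). *)
Definition class_factor (m : nat) (n : nat -> nat) (i : nat) : nat :=
  'C((\sum_(0 <= j < m.+1 | j <= i) n (i - j)).-1, n i).

Lemma card_cells (B : ferrers) : #|cells B| = sumn B.
Proof.
have -> : #|cells B| = \sum_(c : cell B) (c.2 < nth 0 B c.1 : nat).
  rewrite -sum1_card big_mkcond /=; apply: eq_bigr => c _.
  by rewrite inE; case: ifP.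
rewrite -(pair_bigA _ (fun (j : 'I_(size B)) (i : 'I_(\max_(b <- B) b)) =>
  nat_of_bool (i < nth 0 B j))) /=.
rewrite sumnE [RHS](big_nth 0) [RHS]big_mkord; apply: eq_bigr => j _.
have le_j : nth 0 B j <= \max_(b <- B) b.
  by rewrite (big_rem _ (mem_nth 0 (ltn_ord j))) /= leq_maxl.
rewrite (eq_bigr (fun i : 'I__ => if i < nth 0 B j then 1 else 0)) => [|i _].
  by rewrite -big_mkcond /= -(big_ord_widen _ (fun=> 1) le_j) sum1_card card_ord.
by case: ifP.
Qed.

Lemma size_le_area (B : ferrers) : size B <= #|cells B|.
Proof.
rewrite card_cells; case: B => s /= /andP[_].
by elim: s => //= x s IHs /andP[x0 /IHs]; rewrite -add1n; exact: leq_add.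
Qed.

Lemma size_padded (B : ferrers) : size (padded #|cells B| B) = #|cells B|.+1.
Proof. by rewrite size_cat size_nseq subnK // leqW // size_le_area. Qed.

Lemma padded0 (B : ferrers) : nth 0 (padded #|cells B| B) 0 = 0.
Proof. by rewrite nth_cat size_nseq subn_gt0 ltnS size_le_area nth_nseq if_same. Qed.

Lemma omega_le (m : nat) (B : ferrers) (x : int) :
  x \in omega m (padded #|cells B| B) -> (x <= (m * #|cells B|)%:Z)%R.
Proof.
case/mapP => j; rewrite mem_iota size_padded add0n ltnS /= => le_jN ->.
rewrite Num.Theory.lerBlDr -PoszD lez_nat mulnC.
by apply: leq_trans (leq_addr _ _); rewrite leq_mul2l le_jN orbT.
Qed.

(* The factors of index i > m |B| of the infinite product are equal to 1. *)
Lemma class_factor1 (m : nat) (B : ferrers) (i : nat) : m * #|cells B| < i ->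
  class_factor m (occurrences (omega m (padded #|cells B| B))) i = 1.
Proof.
move=> lt_i; rewrite /class_factor (_ : occurrences _ i = 0) ?bin0 //.
by apply/count_memPn/negP => /omega_le; rewrite lez_nat leqNgt lt_i.
Qed.

(* Main.v *)
(* Adding the columns of B from left to right, a new rook in a row of y rooks
   has relative weight 1 - y m, and every row already used meets the new, taller
   column; hence sum_k f_k x(x - m)...(x - (n - k) m) is the product of the
   x - a over the n + 1 entries a of omega_m(B), and the class of B is determined
   by the multiset of these entries.  With |B| + 1 columns the entries are
   natural numbers, and the boards of the class become the words starting with 0,
   with that multiset of letters, in which a letter exceeds its predecessor by at
   most m.  Such words are built by inserting the letters in increasing order:
   the n_i letters i go into the gaps following the n_(i-1) + ... + n_(i-m)
   letters i - m, ..., i - 1, and erasing them again leaves a word of the same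
   kind. *)
Require Import Defs.
From mathcomp Require Import all_boot all_order all_algebra.
From mathcomp Require Import zify ring.

Set Implicit Arguments.
Unset Strict Implicit.
Unset Printing Implicit Defensive.
Import GRing.Theory.

(** * Factorization of the file polynomial *)

Lemma fallingS (x : int) (y m : nat) :
  (falling x y.+1 m = falling x y m * (x - (y * m)%:Z))%R.
Proof. by rewrite /falling big_ord_recr. Qed.

Definition fall_poly (m r : nat) : {poly int} :=
  (\prod_(s < r) ('X - ((s * m)%:Z)%:P))%R.

Lemma fall_polyS (m r : nat) :
  (fall_poly m r.+1 = fall_poly m r * ('X - ((r * m)%:Z)%:P))%R.
Proof. by rewrite /fall_poly big_ord_recr. Qed.

Lemma size_fall_poly (m r : nat) : size (fall_poly m r) = r.+1.
Proof. by rewrite size_prod_XsubC /index_enum -enumT size_enum_ord. Qed.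

Lemma fall_poly_monic (m r : nat) : fall_poly m r \is monic.
Proof. exact: monic_prod_XsubC. Qed.

Section AddColumn.

Variables (m : nat) (B : ferrers).

(** Partial placements for the induction over columns. They remain sets of cells of the whole board,
    so row counts and weights need no change of type when a column is added. *)
Definition placement_upto (j : nat) (F : {set cell B}) :=
  file_placement F && [forall c in F, c.1 < j].

Lemma placement_uptoP (j : nat) (F : {set cell B}) :
  reflect [/\ forall c, c \in F -> c.2 < nth 0 B c.1,
              forall c d, c \in F -> d \in F -> c.1 = d.1 -> c = d
            & forall c, c \in F -> c.1 < j]
          (placement_upto j F).
Proof.
apply: (iffP andP) => [[/andP[/subsetP sF /forall_inP iF] /forall_inP cF]|].
  split=> // [c /sF|c d cF' dF ecd]; first by rewrite inE.
  by apply/eqP; have /forall_inP/(_ d dF)/implyP := iF c cF'; apply; rewrite ecd.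
move=> [sF iF cF]; split; last exact/forall_inP.
apply/andP; split; first by apply/subsetP => c /sF; rewrite inE.
apply/forall_inP => c cF'; apply/forall_inP => d dF; apply/implyP => /eqP ecd.
exact/eqP/iF.
Qed.

Lemma placement_upto_full (F : {set cell B}) :
  placement_upto (size B) F = file_placement F.
Proof.
rewrite /placement_upto andb_idr // => _; exact/forall_inP.
Qed.

Lemma placement_upto0 (F : {set cell B}) : placement_upto 0 F = (F == set0).
Proof.
apply/placement_uptoP/eqP => [[_ _ F0]|->].
  by apply/setP => c; rewrite inE; apply/negP => /F0.
by split=> [c|c d|c]; rewrite inE.
Qed.

Lemma card_placement_upto (j : nat) (F : {set cell B}) :
  j <= size B -> placement_upto j F -> #|F| <= j.
Proof.
move=> lejB /placement_uptoP[_ iF cF].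
rewrite -(card_in_imset iF).
have -> : j = #|[set i : 'I_(size B) | i < j]|.
  by rewrite cardsE -sum1_card -(big_ord_widen _ (fun=> 1) lejB) sum1_card card_ord.
apply: subset_leq_card; apply/subsetP => _ /imsetP[c /cF cj ->].
by rewrite inE.
Qed.

Definition row_count (F : {set cell B}) (i : 'I_(\max_(b <- B) b)) : nat :=
  #|[set c in F | c.2 == i]|.

Lemma wtE (F : {set cell B}) :
  (wt m F = \prod_i falling 1 (row_count F i) m)%R.
Proof.
rewrite /wt; apply: eq_bigr => i _; congr falling.
Qed.

Lemma sum_row_count (F : {set cell B}) : \sum_i row_count F i = #|F|.
Proof.
rewrite -sum1_card (partition_big (fun c : cell B => c.2) predT) //=.
apply: eq_bigr => i _; rewrite /row_count -sum1_card.
by apply: eq_bigl => c; rewrite inE.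
Qed.

(** Only the row of the new rook changes, and its falling factorial gains one last factor. *)
Lemma wtU1 (c : cell B) (F : {set cell B}) : c \notin F ->
  (wt m (c |: F) = wt m F * (1 - (row_count F c.2 * m)%:Z))%R.
Proof.
move=> cF; rewrite !wtE (bigD1 c.2) //= [X in _ = (X * _)%R](bigD1 c.2) //=.
have -> : row_count (c |: F) c.2 = (row_count F c.2).+1.
  rewrite /row_count (_ : finset _ = c |: [set d in F | d.2 == c.2]).
    by rewrite cardsU1 inE (negPf cF).
  apply/setP => d; rewrite !inE.
  by case: (eqVneq d c) => [->|]; rewrite ?eqxx.
rewrite fallingS mulrAC; congr (_ * _ * _)%R; apply: eq_bigr => i ic.
congr falling; rewrite /row_count; apply: eq_card => d; rewrite !inE.
by case: (eqVneq d c) => [->|//]; rewrite (negPf cF) eq_sym (negPf ic).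
Qed.

Lemma heights_mono (i j : nat) : i <= j -> j < size B -> nth 0 B i <= nth 0 B j.
Proof.
move=> leij ltj; have /andP[sB _] := valP B.
by apply: (sorted_leq_nth leq_trans leqnn) => //; rewrite inE //; apply: leq_ltn_trans ltj.
Qed.

(** Heights increase weakly, so every rook of F, being to the left of column j, lies in a row that
    meets column j. The row counts over these rows therefore add up to [#|F|]. *)
Lemma sum_column (j : 'I_(size B)) (F : {set cell B}) : placement_upto j F ->
  (\sum_(i < \max_(b <- B) b | (i < nth 0%N B j)%N) (1 - (row_count F i * m)%:Z) =
   (nth 0%N B j)%:Z - (#|F| * m)%:Z)%R.
Proof.
move=> /placement_uptoP[sF _ cF].
have leM : nth 0 B j <= \max_(b <- B) b.
  by rewrite (big_rem _ (mem_nth 0 (ltn_ord j))) /= leq_maxl.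
rewrite sumrB; congr (_ - _)%R.
  by rewrite -(big_ord_widen _ (fun=> 1%R) leM) sumr_const card_ord pmulrn intz.
rewrite -(big_morph Posz PoszD (erefl _)); congr Posz.
rewrite -sum_row_count big_distrl /= [RHS](bigID (fun i : 'I__ => i < nth 0 B j)) /=.
rewrite [X in _ = addn _ X]big1 ?addn0 // => i.
rewrite -leqNgt => leji; rewrite /row_count (_ : finset _ = set0) ?cards0 //.
apply/setP => c; rewrite !inE; apply/negP => /andP[cF' /eqP ci].
have := leq_trans (sF c cF') (heights_mono (ltnW (cF c cF')) (ltn_ord j)).
by rewrite ci ltnNge leji.
Qed.

(** Either column j is empty, or it holds exactly one rook, whose removal leaves a placement on the
    first j columns. *)
Lemma sum_placement_uptoS (V : zmodType) (g : {set cell B} -> V)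
    (j : 'I_(size B)) :
  (\sum_(F | placement_upto j.+1 F) g F = \sum_(F | placement_upto j F) g F +
   \sum_(i < \max_(b <- B) b | (i < nth 0%N B j)%N)
     \sum_(F | placement_upto j F) g ((j, i) |: F))%R.
Proof.
rewrite (bigID (placement_upto j)) /=; congr (_ + _)%R.
  apply: eq_bigl => F; rewrite andbC andb_idr // => /placement_uptoP[sF iF cF].
  by apply/placement_uptoP; split=> // c /cF; exact: leqW.
(* The inner sum has one term if column j is occupied and none otherwise, so it encodes the
   condition that F does not fit in the first j columns. *)
transitivity (\sum_(F | placement_upto j.+1 F)
   \sum_(i | (j, i) \in F) g F)%R.
  rewrite big_mkcondr /=; apply: eq_bigr => F plF.
  case: ifP => [|/negbFE plF'].
    case/placement_uptoP: plF => sF iF cF nplF.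
    have /exists_inP[c cF' /eqP cj] : [exists c in F, c.1 == j].
      apply: contraR nplF => /exists_inPn nj.
      apply/placement_uptoP; split=> // c cF'.
      by rewrite ltn_neqAle -ltnS cF // andbT; exact: nj.
    rewrite (big_pred1 c.2) // => i /=; apply/idP/eqP => [jiF|->].
      by rewrite -(iF _ _ jiF cF' (esym cj)).
    by rewrite -cj -surjective_pairing.
  rewrite big_pred0 // => i; apply/negP => jiF.
  by case/placement_uptoP: plF' => _ _ /(_ _ jiF); rewrite ltnn.
rewrite (exchange_big_dep predT) //= [RHS]big_mkcond /=.
apply: eq_bigr => i _; case: ifP => [ltib|leib]; last first.
  by rewrite big_pred0 // => F; apply/negP => /andP[/placement_uptoP[/(_ (j, i))]];
     rewrite leib => h _ _ /h.
(* Adding and removing the rook [(j, i)] are inverse to each other. *)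
rewrite (reindex_onto (fun F => (j, i) |: F) (fun F => F :\ (j, i))) /=.
  apply: eq_bigl => F; rewrite setU11 andbT.
  apply/andP/idP => [[/placement_uptoP[sF iF cF] /eqP eF]|plF].
    have jiF : (j, i) \notin F by rewrite -eF !inE eqxx.
    apply/placement_uptoP; split=> [c cF'|c d cF' dF|c cF'].
    - by apply: sF; rewrite inE cF' orbT.
    - by apply: iF; rewrite inE (cF', dF) orbT.
    have cU : c \in (j, i) |: F by rewrite inE cF' orbT.
    rewrite ltn_neqAle -ltnS cF // andbT; apply: contra jiF => /eqP cj.
    by rewrite (iF _ _ (setU11 _ F) cU) //; apply: val_inj.
  have jF k : (j, k) \notin F.
    by apply/negP => jkF; case/placement_uptoP: plF => _ _ /(_ _ jkF); rewrite ltnn.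
  rewrite setU1K //; split=> //; case/placement_uptoP: plF => sF iF cF.
  have neqF (c : cell B) : c \in F -> c.1 <> j.
    by case: c => c1 c2 cF' /= cj; move: (jF c2); rewrite -cj cF'.
  apply/placement_uptoP; split=> [c|c d|c].
  - by case/setU1P => [->|/sF].
  - case/setU1P => [->|cF'] /setU1P[->|dF] // ecd; last exact: iF.
      by case: (neqF _ dF).
    by case: (neqF _ cF').
  - by case/setU1P => [->|/cF /leqW].
by move=> F /andP[_ jiF]; rewrite setD1K.
Qed.

(** Here z stands for the number of zero columns on the left. Leaving column j empty lengthens the
    falling factorial of F by X - (z + j - |F|) m; a rook in column j keeps its length and
    contributes b_j - |F| m in total. The sum X - ((z + j) m - b_j) no longer depends on F and
    factors out. *)
Lemma sum_placement_upto (z j : nat) : j <= size B ->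
  (\sum_(F | placement_upto j F) wt m F *: fall_poly m (z + j - #|F|) =
   fall_poly m z * \prod_(i < j) ('X - (((z + i) * m)%:Z - (nth 0%N B i)%:Z)%:P))%R.
Proof.
elim: j => [|j IHj] ltjB.
  rewrite (eq_bigl _ _ placement_upto0) big_pred1_eq big_ord0 mulr1.
  rewrite cards0 addn0 subn0 wtE big1 ?scale1r // => i _.
  rewrite /row_count (_ : finset _ = set0) ?cards0 /falling ?big_ord0 //.
  by apply/setP => c; rewrite !inE.
rewrite big_ord_recr mulrA -IHj ?(ltnW ltjB) //= -[j]/(val (Ordinal ltjB)).
rewrite sum_placement_uptoS exchange_big -big_split mulr_suml /=.
apply: eq_bigr => F plF.
(* Keeps the natural subtraction [z + j - #|F|] exact. *)
have leF : #|F| <= z + j.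
  by rewrite (leq_trans (card_placement_upto (ltnW ltjB) plF)) ?leq_addl.
have jF k : (Ordinal ltjB, k) \notin F.
  by apply/negP => jkF; case/placement_uptoP: plF => _ _ /(_ _ jkF); rewrite ltnn.
rewrite (eq_bigr (fun i => wt m F *: ((1 - (row_count F i * m)%:Z)%R *:
  fall_poly m (z + j - #|F|)))%R); last first.
  by move=> i _; rewrite (wtU1 (jF i)) cardsU1 jF addnS subSS -scalerA.
rewrite -scaler_sumr -scaler_suml (@sum_column (Ordinal ltjB) F plF) addnS subSn // fall_polyS.
rewrite -scalerAl -scalerDr; congr (_ *: _)%R.
rewrite -mul_polyC mulrC -mulrDl mulrC; congr (_ * _)%R.
rewrite mulnBl -subzn ?leq_mul2r ?leF ?orbT //= !rmorphB /=.
ring.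
Qed.

(** The padding columns have height 0 and contribute the factors X - s m for s < z, which form
    [fall_poly m z]. *)
Lemma file_factorization (n : nat) : size B <= n.+1 ->
  (\sum_(k < n.+2) file_number k m B *: fall_poly m (n.+1 - k) =
   \prod_(a <- omega m (padded n B)) ('X - a%:P))%R.
Proof.
move=> leBn; set z := n.+1 - size B.
have szp : size (padded n B) = z + size B by rewrite size_cat size_nseq.
have zB : z + size B = n.+1 by rewrite subnK.
have -> : (\prod_(a <- omega m (padded n B)) ('X - a%:P) = fall_poly m z *
    \prod_(i < size B) ('X - (((z + i) * m)%:Z - (nth 0%N B i)%:Z)%:P))%R.
  rewrite big_map szp -[z + size B]subn0 -/(index_iota 0 _) big_mkord.
  rewrite big_split_ord /=; congr (_ * _)%R.
    apply: eq_bigr => i _.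
    by rewrite nth_cat size_nseq ltn_ord nth_nseq ltn_ord subr0.
  by apply: eq_bigr => i _; rewrite nth_cat size_nseq ltnNge leq_addr addKn.
rewrite -sum_placement_upto // zB (eq_bigl _ _ placement_upto_full).
(* With this bound [inord #|F|] below is [#|F|] itself, and placements can be grouped by number of
   rooks. *)
have leF (F : {set cell B}) : file_placement F -> #|F| < n.+2.
  rewrite -placement_upto_full => /(card_placement_upto (leqnn _)) /leq_trans; exact.
rewrite [RHS](partition_big (fun F : {set cell B} => inord #|F| : 'I_n.+2) predT) //=.
apply: eq_bigr => k _; rewrite /file_number scaler_suml.
apply: eq_big => [F|F /andP[_ /eqP->] //].
by apply: andb_id2l => /leF ltF; rewrite -val_eqE /= inordK.
Qed.

End AddColumn.

(** * Equivalence of boards as equality of multisets *)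

Lemma fall_poly_free (m n : nat) (c : nat -> int) :
  (\sum_(k < n) c k *: fall_poly m k = 0)%R -> forall k, k < n -> c k = 0%R.
Proof.
elim: n => // n IHn; rewrite big_ord_recr /= => sum0.
(* The terms of index below n have degree below n and [fall_poly m n] is monic, so the coefficient
   of X^n isolates [c n]. *)
have cn0 : c n = 0%R.
  move/(congr1 (fun p : {poly int} => p`_n)%R): sum0.
  rewrite coefD coefZ coef0 coef_sum big1 => [|i _]; last first.
    by rewrite coefZ nth_default ?mulr0 // size_fall_poly.
  have := monicP (fall_poly_monic m n).
  by rewrite /lead_coef size_fall_poly /= => ->; rewrite add0r mulr1.
move=> k; rewrite ltnS leq_eqVlt => /predU1P[->//|]; apply: IHn.
by move: sum0; rewrite cn0 scale0r addr0.
Qed.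

Lemma file_number_gt (k m : nat) (B : ferrers) :
  size B < k -> file_number k m B = 0%R.
Proof.
move=> ltBk; rewrite /file_number big_pred0 // => F.
apply/negP => /andP[]; rewrite -placement_upto_full.
by move=> /(card_placement_upto (leqnn _)) + /eqP eF; rewrite eF leqNgt ltBk.
Qed.

(** The multiset of roots is read off over the field of rationals. *)
Lemma perm_eq_prod_XsubC (s t : seq int) :
  (\prod_(a <- s) ('X - a%:P) = \prod_(a <- t) ('X - a%:P))%R -> perm_eq s t.
Proof.
move/(congr1 (map_poly (intr : int -> rat))); rewrite !map_prod_XsubC => eq_st.
apply: (perm_map_inj (@intr_inj rat)); apply: prod_XsubC_eq.
by rewrite !big_map.
Qed.

(** The file numbers are the coordinates of the product in the falling factorials, and the product
    determines its roots with multiplicity. *)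
Lemma weight_file_equivP (m n : nat) (B B' : ferrers) :
  size B <= n.+1 -> size B' <= n.+1 ->
  weight_file_equiv m B B' <->
  perm_eq (omega m (padded n B)) (omega m (padded n B')).
Proof.
move=> leB leB'; split=> [eqB|/(perm_big _) eqB k].
  apply: perm_eq_prod_XsubC; rewrite -!file_factorization //.
  by apply: eq_bigr => k _; rewrite eqB.
have [ltnk|lekn] := ltnP n.+1 k.
  by rewrite !file_number_gt // (leq_ltn_trans _ ltnk).
apply/eqP; rewrite -subr_eq0; apply/eqP.
(* The index is reversed: [fall_poly m k] carries the file number of [n.+1 - k] rooks. *)
have := @fall_poly_free m n.+2 (fun k =>
  file_number (n.+1 - k) m B - file_number (n.+1 - k) m B')%R.
move=> /(_ _ (n.+1 - k)) /=; rewrite subKn //; apply; last first.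
  by rewrite ltnS leq_subr.
rewrite (reindex_inj rev_ord_inj) /=.
under eq_bigr => i _ do rewrite subSS subKn -1?ltnS // scalerBl.
by rewrite sumrB !file_factorization // eqB subrr.
Qed.

Lemma sumn_padded (n : nat) (B : ferrers) : sumn (padded n B) = sumn B.
Proof. by rewrite sumn_cat sumn_nseq mul0n. Qed.

Lemma sum_omega (m : nat) (b : seq nat) :
  (\sum_(a <- omega m b) a = (\sum_(0 <= j < size b) j * m)%N%:Z - (sumn b)%:Z)%R.
Proof.
rewrite sumnE [X in (_ - Posz X)%R](big_nth 0) !(big_morph Posz PoszD (erefl _)) -sumrB.
by rewrite big_map /index_iota subn0.
Qed.

(** The entries of [omega] add up to a number depending only on m and the length, minus the area.
    The length used fits both boards, since an equivalent board is not yet known to have at most |B|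
    + 1 columns. *)
Lemma weight_file_equiv_area (m : nat) (B B' : ferrers) :
  weight_file_equiv m B B' -> sumn B = sumn B'.
Proof.
have leB : size B <= (size B + size B').+1 by rewrite leqW ?leq_addr.
have leB' : size B' <= (size B + size B').+1 by rewrite leqW ?leq_addl.
move/(weight_file_equivP m leB leB') => eqw.
have szE : size (padded (size B + size B') B) = size (padded (size B + size B') B').
  by rewrite !size_cat !size_nseq !subnK.
have : (\sum_(a <- omega m (padded (size B + size B') B)) a =
         \sum_(a <- omega m (padded (size B + size B') B')) a)%R by exact: perm_big.
by rewrite !sum_omega !sumn_padded szE => /addrI/oppr_inj[].
Qed.

(** * Words with bounded ascents *)

Section Insertions.

Variables (T : eqType) (r : rel T) (x : T).

(** All ways of inserting k copies of x into w, where a is the letter standing before w and each x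
    must follow a letter related to it by r. Each call either consumes a letter of w or places an x,
    hence the nested fixpoints. *)
Fixpoint insertions (w : seq T) : nat -> T -> seq (seq T) :=
  fix ins (k : nat) (a : T) :=
  let first := if k is k'.+1 then
    if r a x then [seq x :: u | u <- ins k' x] else [::] else [::] in
  if w is c :: w' then [seq c :: u | u <- insertions w' k c] ++ first
  else if k is 0 then [:: [::]] else first.

Hypothesis rxx : r x x.

Lemma mem_map_cons (c : T) (u : seq T) (s : seq (seq T)) :
  (u \in [seq c :: v | v <- s]) = (if u is d :: v then (d == c) && (v \in s) else false).
Proof.
apply/mapP/idP => [[v vs ->]|]; first by rewrite eqxx.
by case: u => // d v /andP[/eqP-> vs]; exists v.
Qed.

(** Under these hypotheses a step of u can fail only where it enters x, which is exactly what
    [insertions] tests. *)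
Lemma mem_insertions (w : seq T) (k : nat) (a : T) (u : seq T) :
  x \notin w -> all (r x) w -> path r a w ->
  (u \in insertions w k a) =
    [&& path r a u, filter (predC1 x) u == w & count_mem x u == k].
Proof.
elim: w k a u => [|c w IHw] k a u.
  move=> _ _ _; elim: k a u => [|k IHk] a u /=.
    rewrite inE; case: u => //= y u; rewrite [in RHS]/predC1 /=.
    by case: (y == x); rewrite ?andbF.
  case: u => [|y u]; first by case: ifP; rewrite // mem_map_cons.
  case: ifP => rax; last first.
    by case: (eqVneq y x) => [->|yx] /=; rewrite ?rax ?yx ?andbF.
  rewrite mem_map_cons /=; case: (eqVneq y x) => [->|yx] /=; last by rewrite andbF.
  by rewrite rax IHk.
rewrite inE negb_or => /andP[xc xw] /= /andP[rxc rxw] /andP[rac pcw].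
elim: k a u rac => [|k IHk] a u rac /=; rewrite mem_cat mem_map_cons.
  rewrite in_nil orbF; case: u => [|y u] //; rewrite IHw //=.
  case: (eqVneq y x) => [->|yx] /=; first by rewrite (negPf xc) ?andbF.
  by rewrite eqseq_cons; case: eqP => [->|]; rewrite ?rac ?andbF ?add0n.
case: u => [|y u]; first by case: ifP; rewrite ?mem_map_cons.
case: (eqVneq y x) => [->|yx] /=.
  rewrite (negPf xc) /=; case: ifP => //= rax.
  by rewrite mem_map_cons eqxx IHk.
rewrite IHw // yx eqseq_cons (negPf yx) add0n (fun_if (fun s => _ \in s)) mem_map_cons.
rewrite (negPf yx) if_same orbF.
by case: eqP => [->|]; rewrite ?rac ?andbF.
Qed.

Lemma insertions_uniq (w : seq T) (k : nat) (a : T) :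
  x \notin w -> uniq (insertions w k a).
Proof.
have cons_inj (c : T) : injective (cons c) by move=> u v [].
elim: w k a => [|c w IHw] k a.
  move=> _; elim: k a => //= k IHk a; case: ifP => // _.
  by rewrite map_inj_uniq.
rewrite inE negb_or => /andP[xc xw].
elim: k a => [|k IHk] a /=; rewrite cat_uniq map_inj_uniq // IHw //=.
case: ifP => // _; rewrite map_inj_uniq // IHk andbT.
by apply/hasPn => _ /mapP[u _ ->]; rewrite mem_map_cons (negPf xc).
Qed.

(** Stars and bars: k equal letters are distributed over the gaps that follow the letters of
    [a :: w] related to x. *)
Lemma size_insertions (w : seq T) (k : nat) (a : T) :
  size (insertions w k a) = 'C((k + count (r^~ x) (a :: w)).-1, k).
Proof.
elim: w k a => [|c w IHw] k a.
  elim: k a => [|k IHk] a //=; first by rewrite bin0.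
  case: ifP => rax; last by rewrite bin_small // !addn0.
  by rewrite size_map IHk /= rxx !addn0 !addn1 /= !binn.
elim: k a => [|k IHk] a; first by rewrite /= cats0 size_map IHw !bin0.
rewrite [insertions _ _ _]/= size_cat size_map IHw [count _ (a :: _)]/=.
(* Placing an x makes x the preceding letter; by [rxx] its gap is open too, so the number of gaps is
   unchanged and Pascal's rule applies. *)
case: ifP => rax; last by rewrite addn0.
by rewrite size_map IHk [count _ (x :: _)]/= rxx /= !addSn !addnS /= binS.
Qed.

End Insertions.

Section Words.

Variable m : nat.

Definition step : rel nat := fun a b => b <= a + m.

(** Here b is the letter just read and a the last letter kept. If they may differ, copies of x have
    been erased since a, so x <= a + m; the next letter kept is at most x, hence also at most a +
    m. *)
Lemma path_step_filter (x a b : nat) (u : seq nat) :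
  (a == b) || (x <= a + m) -> all (leq^~ x) u -> path step b u ->
  path step a (filter (predC1 x) u).
Proof.
elim: u a b => //= y u IHu a b ab /andP[leyx leux] /andP[sby pyu].
have lexa : y = x -> x <= a + m.
  by move=> yx; case/orP: ab => // /eqP->; rewrite -yx.
case: eqVneq => [yx|nyx] /=; first by apply: IHu pyu; rewrite ?lexa ?orbT.
rewrite (IHu y y) ?eqxx // andbT; case/orP: ab => [/eqP->//|].
exact: leq_trans leyx.
Qed.

Lemma step_above (i : nat) (w : seq nat) : all (leq^~ i) w ->
  i.+1 \notin w /\ all (step i.+1) w.
Proof.
move=> /allP lew; split; first by apply/negP => /lew; rewrite ltnn.
by apply/allP => y /lew leyi; rewrite /step leqW // (leq_trans leyi) ?leq_addr.
Qed.

(** Makes the heights j m - u_j nonnegative when a word is turned back into a board. *)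
Lemma path_step_nth_le (u : seq nat) (a j : nat) :
  path step a u -> j < (size u).+1 -> nth 0 (a :: u) j <= a + j * m.
Proof.
elim: u a j => [|b u IHu] a [|j] //=; rewrite ?leq_addr // => /andP[sab pu].
rewrite ltnS => /(IHu _ _ pu) /leq_trans; apply.
by rewrite mulSn addnA leq_add2r.
Qed.

(** A letter a in the window is counted once, at j = x - a. The condition j <= x keeps truncated
    subtraction from counting the letter 0 repeatedly. *)
Lemma count_window (x : nat) (s : seq nat) : all (ltn^~ x) s ->
  count (fun a => x <= a + m) s =
  \sum_(1 <= j < m.+1 | j <= x) count_mem (x - j) s.
Proof.
elim: s => [|a s IHs] /=; first by rewrite big1.
case/andP=> ltax /IHs->; rewrite big_split /=; congr (_ + _).
transitivity (count_mem (x - a) (index_iota 1 m.+1) : nat).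
  by rewrite count_uniq_mem ?iota_uniq // mem_index_iota; lia.
rewrite -sum1_count big_mkcond [RHS]big_mkcond; apply: eq_bigr => j _ /=.
by have [] := leqP j x; have [] := eqVneq j (x - a); have [] := eqVneq a (x - j); lia.
Qed.

Variable n : nat -> nat.

(* The words are stored without their first letter, which is always 0. *)
Fixpoint words (i : nat) : seq (seq nat) :=
  if i is i'.+1
  then [seq u | w <- words i', u <- insertions step i w (n i) 0]
  else [:: nseq (n 0).-1 0].

Hypothesis n0_gt0 : 0 < n 0.

(** Insertion reaches every such word, because erasing its letters i + 1 leaves a word of the same
    kind over the letters up to i. *)
Lemma mem_words (i : nat) (u : seq nat) :
  (u \in words i) = [&& path step 0 u, all (leq^~ i) u &
    all (fun j => count_mem j (0 :: u) == n j) (iota 0 i.+1)].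
Proof.
have stepxx x : step x x by rewrite /step leq_addr.
elim: i u => [|i IHi] u.
  rewrite /= inE andbT; apply/eqP/and3P => [->|[_ /allP u0 /eqP nu]].
    split.
    - by elim: _.-1 => //= k ->.
    - by rewrite all_nseq leqnn orbT.
    - by rewrite count_nseq /= mul1n add1n prednK.
  have /all_pred1P-> : all (pred1 0) u by apply/allP => y /u0; rewrite leqn0.
  congr nseq; rewrite -nu; have -> : count_mem 0 u = size u; last by [].
  by apply/eqP; rewrite -all_count; apply/allP => y /u0; rewrite leqn0.
have wP w : w \in words i -> [/\ i.+1 \notin w, all (step i.+1) w & path step 0 w].
  by rewrite IHi => /and3P[pw /step_above[xw aw] _].
have cntE j : j <= i -> count_mem j (filter (predC1 i.+1) u) = count_mem j u.
  move=> leji; rewrite count_filter; apply: eq_count => y /=.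
  by case: eqVneq => //= ->; rewrite ltn_eqF.
have -> : (u \in words i.+1) = (filter (predC1 i.+1) u \in words i) &&
    (path step 0 u && (count_mem i.+1 u == n i.+1)).
  apply/allpairsPdep/andP => [[w [v [ww vI ->]]]|[ww /andP[pu cu]]].
    have [xw aw pw] := wP w ww; move: vI; rewrite mem_insertions //.
    by move=> /and3P[-> /eqP-> ->].
  have [xw aw pw] := wP _ ww; exists (filter (predC1 i.+1) u), u.
  by split=> //; rewrite mem_insertions // pu cu eqxx.
rewrite IHi -[i.+2]addn1 iotaD all_cat.
have -> : all (fun j => count_mem j (0 :: u) == n j) (iota (0 + i.+1) 1) =
    (count_mem i.+1 u == n i.+1) by rewrite /= andbT.
have [pu|] := boolP (path step 0 u); last by rewrite andbF.
have -> : all (leq^~ i.+1) u = all (leq^~ i) (filter (predC1 i.+1) u).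
  rewrite all_filter; apply: eq_all => y /=; rewrite leq_eqVlt ltnS.
  by case: eqVneq.
have -> : all (fun j => count_mem j (0 :: filter (predC1 i.+1) u) == n j) (iota 0 i.+1)
    = all (fun j => count_mem j (0 :: u) == n j) (iota 0 i.+1).
  by apply: eq_in_all => j; rewrite mem_iota add0n ltnS => /andP[_ leji] /=; rewrite cntE.
rewrite andTb; case: (boolP (all (leq^~ i) _)) => [lei|]; last by rewrite andbF.
(* Erasing the largest letter keeps ascents bounded, so the path condition on the shorter word
   follows from that on u. *)
rewrite (path_step_filter (b := 0)) //=; last first.
  by move: lei; rewrite all_filter; apply: sub_all => y /=; case: eqVneq => [->|_ /leqW].
Qed.

(** A word determines the one it was built from, by erasing the letters inserted last. *)
Lemma words_uniq (i : nat) : uniq (words i).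
Proof.
elim: i => //= i IHi.
have wP w : w \in words i -> [/\ i.+1 \notin w, all (step i.+1) w & path step 0 w].
  by rewrite mem_words => /and3P[pw /step_above[xw aw] _].
apply: allpairs_uniq_dep => // [w /wP[xw _ _]|]; first exact: insertions_uniq.
move=> _ _ /allpairsPdep[w [u [ww uI ->]]] /allpairsPdep[w' [u' [ww' uI' ->]]] /= eqU.
move: uI uI'; rewrite -eqU; have [xw aw pw] := wP _ ww; have [xw' aw' pw'] := wP _ ww'.
rewrite !mem_insertions // ?/step ?leq_addr // => /and3P[_ /eqP <- _] /and3P[_ /eqP <- _].
by [].
Qed.

(** The number of open gaps depends only on the letter counts of w, which are prescribed, so each w
    has the same number of extensions. *)
Lemma size_words (i : nat) :
  size (words i) = \prod_(1 <= k < i.+1) class_factor m n k.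
Proof.
elim: i => [|i IHi]; first by rewrite big_geq.
rewrite big_nat_recr //= -IHi size_allpairs_dep.
have sizeE w : w \in words i ->
    size (insertions step i.+1 w (n i.+1) 0) = class_factor m n i.+1.
  rewrite mem_words => /and3P[pw lew /allP cw].
  rewrite size_insertions ?/step ?leq_addr // /class_factor; congr ('C(_.-1, _)).
  rewrite (count_window (s := 0 :: w)); last first.
    by rewrite /=; apply: sub_all lew => y; rewrite ltnS.
  (* The term j = 0 is the number of letters inserted; the other terms count the gaps. *)
  rewrite [RHS]big_ltn_cond // subn0.
  congr (_ + _); rewrite big_nat_cond [RHS]big_nat_cond.
  apply: eq_bigr => j /andP[/andP[j1 _] leji]; apply/eqP; apply: cw.
  by rewrite mem_iota; lia.
by rewrite sumnE big_map (eq_big_seq _ sizeE) big_const_seq count_predT iter_addn_0 mulnC.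
Qed.

End Words.

(** * Boards as words *)

Lemma sorted_nth_mul_le_sumn (s : seq nat) (j : nat) :
  sorted leq s -> (size s - j) * nth 0 s j <= sumn s.
Proof.
move=> s_sorted; case: (leqP j (size s)) => [lejs|/ltnW]; last by rewrite -subn_eq0 => /eqP->.
rewrite sumnE (big_nth 0) (big_cat_nat (leq0n j) lejs) /=.
rewrite -sum_nat_const_nat; apply: leq_trans (leq_addl _ _).
rewrite big_nat_cond [leqRHS]big_nat_cond; apply: leq_sum => i /andP[/andP[leji ltis] _].
by apply: (sorted_leq_nth leq_trans leqnn) => //; rewrite inE //; apply: leq_ltn_trans ltis.
Qed.

Lemma padded_sorted (n : nat) (B : ferrers) : sorted leq (padded n B).
Proof.
have /andP[sB _] := valP B; rewrite /padded.
elim: (n.+1 - size B) => [|k IHk] //=.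
by rewrite path_min_sorted //; apply/allP.
Qed.

Lemma filter_padded (n : nat) (B : ferrers) : filter (leq 1) (padded n B) = B.
Proof.
have /andP[_ /all_filterP aB] := valP B.
by rewrite filter_cat aB filter_nseq.
Qed.

Lemma sorted_padded (b : seq nat) : sorted leq b ->
  b = nseq (size b - size (filter (leq 1) b)) 0 ++ filter (leq 1) b.
Proof.
elim: b => //= a b IHb pab; case: a pab => [|a] pab /=.
  rewrite subSn ?size_filter ?count_size //= -size_filter.
  by rewrite -IHb ?(path_sorted pab).
have /all_filterP -> : all (leq 1) b.
  by apply: sub_all (order_path_min leq_trans pab) => y; exact: leq_trans.
by rewrite subnn.
Qed.

Lemma size_padded_area (n : nat) (B : ferrers) : sumn B = n -> size (padded n B) = n.+1.
Proof. by move=> <-; rewrite -card_cells size_padded. Qed.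

Section BoardWord.

Variables (m N : nat).

(* The entries of omega_m(0, b_1, ..., b_N) after the initial 0. *)
Definition board_word (B : ferrers) : seq nat :=
  [seq j * m - nth 0 (padded N B) j | j <- iota 1 N].

Lemma cons_board_word (B : ferrers) :
  0 :: board_word B = [seq j * m - nth 0 (padded N B) j | j <- iota 0 N.+1].
Proof. by []. Qed.

Lemma nth_board_word (B : ferrers) (j : nat) : j <= N ->
  nth 0 (0 :: board_word B) j = j * m - nth 0 (padded N B) j.
Proof. by move=> lejN; rewrite cons_board_word (nth_map 0) ?size_iota // nth_iota. Qed.

Lemma board_word_le (B : ferrers) : all (leq^~ (m * N)) (board_word B).
Proof.
apply/allP => _ /mapP[j jN ->]; move: jN; rewrite mem_iota add1n ltnS => /andP[_ lejN].
by rewrite mulnC leq_subLR (leq_trans _ (leq_addl _ _)) // leq_mul2l lejN orbT.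
Qed.

Lemma path_board_word (B : ferrers) : sumn B = N -> path (step m) 0 (board_word B).
Proof.
move=> area_B; apply/(pathP 0) => j; rewrite size_map size_iota => ltjN.
rewrite -[nth 0 (board_word B) j]/(nth 0 (0 :: board_word B) j.+1).
rewrite !nth_board_word ?(ltnW ltjN) // /step mulSn.
have := sorted_leq_nth leq_trans leqnn 0 (padded_sorted N B) j j.+1.
rewrite !inE (size_padded_area area_B) !ltnS ltjN (ltnW ltjN) => /(_ isT isT (leqnSn j)).
lia.
Qed.

(** The heights are j m - u_j; they increase weakly because u ascends by at most m. The area of the
    board is not known at this point, so its [omega] is computed directly. *)
Lemma board_word_surj (u : seq nat) : size u = N -> path (step m) 0 u ->
  exists B : ferrers, [/\ size B <= N.+1, board_word B = u &
    omega m (padded N B) = map Posz (0 :: u)].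
Proof.
move=> su pu; pose b := [seq j * m - nth 0 (0 :: u) j | j <- iota 0 N.+1].
have sb : size b = N.+1 by rewrite size_map size_iota.
have nb j : j <= N -> nth 0 b j = j * m - nth 0 (0 :: u) j.
  by move=> lejN; rewrite (nth_map 0) ?size_iota // nth_iota.
have leu j : j <= N -> nth 0 (0 :: u) j <= j * m.
  by move=> lejN; apply: path_step_nth_le => //; rewrite su.
have b_sorted : sorted leq b.
  apply/(sortedP 0) => j; rewrite sb ltnS => ltjN; rewrite !nb ?(ltnW ltjN) //.
  have := (pathP 0 pu) j; rewrite su => /(_ ltjN); rewrite /step.
  by have := leu _ (ltnW ltjN); rewrite mulSn /=; lia.
have hP : sorted leq (filter (leq 1) b) && all (leq 1) (filter (leq 1) b).
  by rewrite filter_all (sorted_filter leq_trans).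
have padE : padded N (Ferrers hP) = b by rewrite /padded /= -sb -sorted_padded.
exists (Ferrers hP); split.
- by have := count_size (leq 1) b; rewrite -size_filter sb.
- apply: (@eq_from_nth _ 0); rewrite size_map size_iota // => j ltjN.
  rewrite (nth_map 0) ?size_iota // nth_iota // padE add1n nb //.
  exact: (subKn (leu _ ltjN)).
rewrite padE /omega /mkseq sb; apply: (@eq_from_nth _ 0%R).
  by rewrite !size_map size_iota /= su.
move=> j; rewrite size_map size_iota => ltjN.
rewrite (nth_map 0) ?size_iota // nth_iota // add0n nb //.
rewrite (nth_map 0) /= ?su // -subzn ?leu //.
by rewrite opprB addrC subrK.
Qed.

Hypothesis m_gt0 : 0 < m.

(* (j + 1) (N + 1 - j) > N, so b_j > j would give the columns j, ..., N more
   than N cells. *)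
Lemma padded_le (B : ferrers) (j : nat) :
  sumn B = N -> j <= N -> nth 0 (padded N B) j <= j * m.
Proof.
move=> area_B lejN; have := sorted_nth_mul_le_sumn j (padded_sorted N B).
rewrite (size_padded_area area_B) sumn_padded area_B => le_N.
apply: leq_trans (leq_pmulr j m_gt0); rewrite leqNgt; apply/negP => lt_j.
have := leq_trans (leq_mul (leqnn _) lt_j) le_N; rewrite leqNgt => /negP[].
by move: lejN => /subnK <-; rewrite subSn ?leq_addl // addnK; nia.
Qed.

Lemma omega_board_word (B : ferrers) : sumn B = N ->
  omega m (padded N B) = map Posz (0 :: board_word B).
Proof.
move=> area_B; rewrite cons_board_word /omega /mkseq (size_padded_area area_B) -map_comp.
apply/eq_in_map => j; rewrite mem_iota ltnS /= => lejN.
by rewrite subzn // padded_le.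
Qed.

(** By [padded_le] no subtraction in the words is truncated, so the heights can be recovered. *)
Lemma board_word_inj (B B' : ferrers) : sumn B = N -> sumn B' = N ->
  board_word B = board_word B' -> B = B'.
Proof.
move=> aB aB' eqw; apply: val_inj; rewrite /= -(filter_padded N B) -(filter_padded N B').
congr filter; apply: (@eq_from_nth _ 0); rewrite !size_padded_area // => j ltjN.
have := padded_le aB ltjN; have := padded_le aB' ltjN.
have := nth_board_word B ltjN; rewrite eqw nth_board_word //; lia.
Qed.

End BoardWord.

(** * The bijection between the class and the words *)

Lemma occurrences_map_Posz (s : seq nat) (i : nat) :
  occurrences (map Posz s) i = count_mem i s.
Proof. by rewrite /occurrences count_map; apply: eq_count. Qed.

(* Required only here: these files shadow lemmas of finset. *)
From mathcomp Require Import classical_sets cardinality.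

Theorem theorem8p1 (m : nat) (B : ferrers) (hm : 0 < m) :
  let N := #|cells B| in
  let n := occurrences (omega m (padded N B)) in
  ([set B' : ferrers | weight_file_equiv m B B']
     #= `I_(\prod_(1 <= i < (m * N).+1) class_factor m n i))%classic%card.
Proof.
cbv zeta; set N := #|cells B|; set n := occurrences _.
have aB : sumn B = N by rewrite /N card_cells.
have nE i : n i = count_mem i (0 :: board_word m N B).
  by rewrite /n (omega_board_word hm aB) occurrences_map_Posz.
have n0 : 0 < n 0 by rewrite nE.
have sizeN (B' : ferrers) : sumn B' = N -> size B' <= N.+1.
  by move=> <-; rewrite -card_cells leqW ?size_le_area.
(* Letters up to m N suffice, since b_j >= 0 bounds the j-th letter by j m. *)
rewrite -size_words //; set W := words m n _.
have wordW (B' : ferrers) : weight_file_equiv m B B' ->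
    sumn B' = N /\ board_word m N B' \in W.
  move=> eqB; have aB' : sumn B' = N by rewrite -aB (weight_file_equiv_area eqB).
  split=> //; rewrite mem_words // path_board_word // board_word_le !andTb.
  have := (weight_file_equivP m (sizeN _ aB) (sizeN _ aB')).1 eqB.
  have inj_Posz : injective Posz by move=> x y [].
  rewrite !omega_board_word // => /(perm_map_inj inj_Posz)/seq.permP cntE.
  by apply/allP => j _; rewrite nE -cntE.
(* A board is sent to the position of its word in the repetition-free list [W]. *)
apply/card_set_bijP; exists (fun B' : ferrers => index (board_word m N B') W); split.
- by move=> B' /wordW[_ wW] /=; rewrite index_mem.
- move=> B1 B2; rewrite !inE => /wordW[a1 w1] /wordW[a2 w2] eqi.
  exact: (board_word_inj hm a1 a2 (index_inj [::] w1 w2 eqi)).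
move=> i /= lti; pose u := nth [::] W i.
have uW : u \in W by rewrite mem_nth.
have := uW; rewrite mem_words // => /and3P[pu /allP leu /allP cu].
(* Both words have all letters at most m N, and membership in [W] fixes the counts of these letters.
   The length of u, not recorded in [W], follows from the permutation. *)
have puB : perm_eq (0 :: board_word m N B) (0 :: u).
  apply/allP => j; rewrite mem_cat => jP.
  have lej : j <= m * N.
    have /allP leB := board_word_le m N B.
    by case/orP: jP; rewrite inE => /predU1P[->//|]; [exact: leB | exact: leu].
  by rewrite /= -[X in X == _]nE eq_sym; apply: cu; rewrite mem_iota.
have su : size u = N.
  by have := perm_size puB; rewrite /= size_map size_iota => -[].
have [B' [sB' wB' oB']] := board_word_surj su pu.
exists B'; last by rewrite wB' index_uniq ?words_uniq.
apply/(weight_file_equivP m (sizeN _ aB) sB').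
by rewrite omega_board_word // oB' perm_map.
Qed.
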